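(* Let $G$ be a finite group and $N$ a solvable normal subgroup of $G$. If $u$ is a torsion element of $\mathrm{V}(\mathbb{Z}G,N)$, then the order of $u$ divides $|N|$.
   Context: $\mathbb{Z}G$ is the integral group ring of $G$. The augmentation map $\varepsilon:\mathbb{Z}G\to\mathbb{Z}$ sends $\sum_{g}a_g g$ to $\sum_g a_g$; $\mathrm{V}(\mathbb{Z}G)$ denotes the group of units of $\mathbb{Z}G$ of augmentation $1$ (normalized units). For a normal subgroup $N$ of $G$, $\omega_N:\mathbb{Z}G\to\mathbb{Z}(G/N)$ is the ring homomorphism induced by the natural projection $G\to G/N$, and $\mathrm{V}(\mathbb{Z}G,N)=\{u\in\mathrm{V}(\mathbb{Z}G):\omega_N(u)=1\}$. *)

(* Defs.v *)
(* Integral group ring ZG of a finite group G, encoded as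
   integer-valued functions on the ambient finGroupType gT with support in G. *)
From HB Require Import structures.
From mathcomp Require Import all_boot all_order all_algebra all_fingroup all_solvable.
Set Implicit Arguments. Unset Strict Implicit. Unset Printing Implicit Defensive.
Import GRing.Theory.

Local Open Scope ring_scope.

(* elements sum_g a_g g, a_g in Z *)
Definition gr (gT : finGroupType) := {ffun gT -> int}.

Definition in_ZG (gT : finGroupType) (G : {set gT}) (a : gr gT) : bool :=
  [forall x, (x \notin G) ==> (a x == 0)].

Definition gr_one (gT : finGroupType) : gr gT :=
  [ffun x => if x == 1%g then 1 else 0].

Definition gr_mul (gT : finGroupType) (a b : gr gT) : gr gT :=
  [ffun x => \sum_(y : gT) a y * b (y^-1 * x)%g].

Definition gr_exp (gT : finGroupType) (a : gr gT) (n : nat) : gr gT :=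
  iter n (gr_mul a) (gr_one gT).

Definition unit_ZG (gT : finGroupType) (G : {set gT}) (u : gr gT) : Prop :=
  in_ZG G u /\ exists v, [/\ in_ZG G v, gr_mul u v = gr_one gT & gr_mul v u = gr_one gT].

Definition aug (gT : finGroupType) (a : gr gT) : int := \sum_(x : gT) a x.

(* omega_N : ZG -> Z(G/N), induced by G -> G/N (for a supported in G <= 'N(N)) *)
Definition omega (gT : finGroupType) (N : {set gT}) (a : gr gT) : gr (coset_of N) :=
  [ffun C => \sum_(x : gT | coset N x == C) a x].

Definition in_VZGN (gT : finGroupType) (G N : {set gT}) (u : gr gT) : Prop :=
  [/\ unit_ZG G u, aug u = 1 & omega N u = gr_one (coset_of N)].

(* Main.v *)
(* It suffices to show [u^|N| = 1].  Induction along a chief series of [G] below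
   [N], through [omega_M], reduces this to a minimal normal subgroup [M], which
   is an elementary abelian [p]-group of order [p^r].  With [a := u - 1] one has
   [u^(p^r) = 1 + a^(p^r)] modulo [p], and [a] lies in the ideal generated by the
   augmentation ideal [I(M)], whose power of exponent
   [r (p - 1) + 1 <= p^r] vanishes modulo [p].  So [w := u^|M|] is [1]
   modulo [p].  If [w^q = 1] for a prime [q], then [f := q - (1 + w + ... + w^(q-1))]
   satisfies [f^2 = q f], lies in the kernel of [omega_M] (which is nilpotent
   modulo [p]) and is divisible by [p]; hence it is divisible by every power of
   [p], so [f = 0] and [w = 1]. *)
Require Import Defs.
From HB Require Import structures.
From mathcomp Require Import all_boot all_order all_algebra all_fingroup all_solvable.
Set Implicit Arguments. Unset Strict Implicit. Unset Printing Implicit Defensive.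
Import GRing.Theory.

Local Open Scope ring_scope.

(** * Powers of [1 + x] modulo a prime *)

(** Since [i * 'C(p ^ r, i) = p ^ r * 'C(p ^ r - 1, i - 1)], a binomial coefficient prime to [p]
    would force [p ^ r] to divide [i]. *)
Lemma prime_dvd_binX p r i : prime p -> (0 < i < p ^ r)%N -> (p %| 'C(p ^ r, i))%N.
Proof.
move=> pr /andP[]; case: i => // i _ lt; apply: contraLR lt => ndiv; rewrite -leqNgt.
apply: dvdn_leq => //; rewrite -(@Gauss_dvdl _ _ 'C(p ^ r, i.+1)).
  by rewrite -mul_bin_diag dvdn_mulr.
by rewrite coprimeXl // prime_coprime.
Qed.

Lemma expr1D_modp (R : nzRingType) (x : R) p r : prime p ->
  exists c, (1 + x) ^+ (p ^ r) = 1 + x ^+ (p ^ r) + c *+ p.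
Proof.
move=> pr; have := @prime_dvd_binX p r ^~ pr.
have : (0 < p ^ r)%N by rewrite expn_gt0 prime_gt0.
case: (p ^ r)%N => // q _ dv.
exists (\sum_(i < q) x ^+ i.+1 *+ ('C(q.+1, i.+1) %/ p)).
rewrite exprDn_comm; last exact: commr_sym (commr1 x).
rewrite big_ord_recr big_ord_recl /= subnn binn bin0 expr0 !expr1n.
rewrite !mulr1 !mul1r !mulr1n addrAC; congr (_ + _ + _).
rewrite -sumrMnl; apply: eq_bigr => i _; rewrite expr1n mul1r -mulrnA divnK //.
by apply: dv; rewrite /= ltnS.
Qed.

(** * The ring structure of the group ring *)

Section GroupRing.
Variable gT : finGroupType.
Implicit Types a b c u w : gr gT.

HB.instance Definition _ := GRing.Zmodule.copy (gr gT) {ffun gT -> int}.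

Definition gr_elt (g : gT) : gr gT := [ffun x => (x == g)%:R].

Lemma gr_mulA : associative (@gr_mul gT).
Proof.
move=> a b c; apply/ffunP => x; rewrite !ffunE.
under [RHS]eq_bigr => y _ do rewrite ffunE mulr_suml.
rewrite [RHS]exchange_big; apply: eq_bigr => y _ /=.
rewrite ffunE mulr_sumr (reindex_inj (mulgI y^-1%g)) /=.
by apply: eq_bigr => z _; rewrite mulrA invMg invgK -mulgA mulKVg.
Qed.

Lemma gr_oneE : gr_one gT = gr_elt 1%g.
Proof. by apply/ffunP => x; rewrite !ffunE; case: eqP. Qed.

Lemma gr_mul_eltl g a x : gr_mul (gr_elt g) a x = a (g^-1 * x)%g.
Proof.
rewrite ffunE (bigD1 g) //= ffunE eqxx mul1r big1 ?addr0 // => y /negPf ne.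
by rewrite ffunE ne mul0r.
Qed.

Lemma gr_mul1 : left_id (gr_one gT) (@gr_mul gT).
Proof. by move=> a; apply/ffunP=> x; rewrite gr_oneE gr_mul_eltl invg1 mul1g. Qed.

Lemma gr_mul1r : right_id (gr_one gT) (@gr_mul gT).
Proof.
move=> a; apply/ffunP=> x; rewrite ffunE (bigD1 x) //= ffunE mulVg eqxx mulr1.
rewrite big1 ?addr0 // => y ne.
by rewrite ffunE -eq_mulVg1 (negPf ne) mulr0.
Qed.

Lemma gr_mulDl : left_distributive (@gr_mul gT) +%R.
Proof.
move=> a b c; apply/ffunP=> x; rewrite !ffunE -big_split.
by apply: eq_bigr => y _; rewrite ffunE mulrDl.
Qed.

Lemma gr_mulDr : right_distributive (@gr_mul gT) +%R.
Proof.
move=> a b c; apply/ffunP=> x; rewrite !ffunE -big_split.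
by apply: eq_bigr => y _; rewrite ffunE mulrDr.
Qed.

Lemma gr_one_neq0 : gr_one gT != 0.
Proof. by apply/eqP => /ffunP/(_ 1%g); rewrite !ffunE eqxx. Qed.

HB.instance Definition _ := GRing.Zmodule_isNzRing.Build (gr gT)
  gr_mulA gr_mul1 gr_mul1r gr_mulDl gr_mulDr gr_one_neq0.

Lemma gr_expE a n : gr_exp a n = a ^+ n.
Proof. by elim: n => // n IHn; rewrite exprS -IHn. Qed.

Lemma gr_mulE a b x : (a * b) x = \sum_(y : gT) a y * b (y^-1 * x)%g.
Proof. by rewrite ffunE. Qed.

Lemma gr_elt1 : gr_elt 1%g = 1. Proof. by rewrite -gr_oneE. Qed.

Lemma gr_eltlE g a x : (gr_elt g * a) x = a (g^-1 * x)%g.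
Proof. exact: gr_mul_eltl. Qed.

Lemma gr_eltM g h : gr_elt g * gr_elt h = gr_elt (g * h)%g.
Proof.
by apply/ffunP=> x; rewrite gr_eltlE !ffunE (can2_eq (mulKVg g) (mulKg g)).
Qed.

Lemma gr_eltX g n : gr_elt g ^+ n = gr_elt (g ^+ n)%g.
Proof.
by elim: n => [|n IHn]; rewrite ?expr0 ?gr_elt1 // exprS IHn gr_eltM -expgS.
Qed.

Lemma gr_mulrnE a n x : (a *+ n) x = a x *+ n.
Proof. by elim: n => [|n IHn]; rewrite ?mulr0n ?ffunE // !mulrS ffunE IHn. Qed.

Lemma gr_mulrzE a n x : (a *~ n) x = a x *~ n.
Proof.
case: n => n; first exact: gr_mulrnE.
by rewrite NegzE !mulrNz ffunE gr_mulrnE.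
Qed.

Lemma gr_sum_elt a : a = \sum_x gr_elt x *~ a x.
Proof.
apply/ffunP=> x; rewrite sum_ffunE (bigD1 x) //= gr_mulrzE ffunE eqxx intz.
rewrite big1 ?addr0 // => y ne.
by rewrite gr_mulrzE ffunE eq_sym (negPf ne) mul0rz.
Qed.

Lemma gr_mulrnI n : (0 < n)%N -> injective (fun a => a *+ n).
Proof.
move=> n0 a b /ffunP e; apply/ffunP => x; have := e x.
rewrite !gr_mulrnE => /eqP.
by rewrite Num.Theory.eqrMn2r gtn_eqF //= => /eqP.
Qed.

(** * Divisibility by integers and powers of the augmentation ideal modulo [p] *)

Definition gr_dvd p a := exists c, a = c *+ p.

Lemma gr_dvd0 p : gr_dvd p 0. Proof. by exists 0; rewrite mul0rn. Qed.

Lemma gr_dvdB p a b : gr_dvd p a -> gr_dvd p b -> gr_dvd p (a - b).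
Proof. by move=> [c ->] [d ->]; exists (c - d); rewrite mulrnBl. Qed.

Lemma gr_dvdM p a b : gr_dvd p b -> gr_dvd p (a * b).
Proof. by move=> [c ->]; exists (a * c); rewrite mulrnAr. Qed.

(* [aug_ann p H k a] says that [I(H)^k a] lies in [p ZG], where [I(H)] is the
   augmentation ideal of [ZH]. *)
Fixpoint aug_ann p (H : {set gT}) k a : Prop :=
  if k is k'.+1 then forall h, h \in H -> aug_ann p H k' ((gr_elt h - 1) * a)
  else gr_dvd p a.

Lemma aug_annB p H k a b : aug_ann p H k a -> aug_ann p H k b -> aug_ann p H k (a - b).
Proof.
elim: k a b => [|k IH] a b /=; first exact: gr_dvdB.
by move=> Ha Hb h hH; rewrite mulrBr; apply: IH; auto.
Qed.

Lemma aug_ann0 p H k : aug_ann p H k 0.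
Proof. by elim: k => [|k IH] /=; [exact: gr_dvd0 | move=> h _; rewrite mulr0]. Qed.

Lemma aug_annN p H k a : aug_ann p H k a -> aug_ann p H k (- a).
Proof. by move=> Ha; rewrite -sub0r; apply: aug_annB => //; apply: aug_ann0. Qed.

Lemma aug_annD p H k a b : aug_ann p H k a -> aug_ann p H k b -> aug_ann p H k (a + b).
Proof. by move=> Ha /aug_annN Hb; have := aug_annB Ha Hb; rewrite opprK. Qed.

Lemma aug_ann_sum p H k (I : Type) (r : seq I) (P : pred I) (F : I -> gr gT) :
  (forall i, P i -> aug_ann p H k (F i)) -> aug_ann p H k (\sum_(i <- r | P i) F i).
Proof.
move=> HF; apply: (big_ind (aug_ann p H k)) => //; first exact: aug_ann0.
by move=> a b; apply: aug_annD.
Qed.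

Lemma aug_annMz p H k a n : aug_ann p H k a -> aug_ann p H k (a *~ n).
Proof.
have nat_case m : aug_ann p H k a -> aug_ann p H k (a *+ m).
  move=> Ha; rewrite -[m]card_ord -sumr_const.
  by apply: aug_ann_sum.
by move=> Ha; case: n => n; last rewrite NegzE mulrNz; try apply: aug_annN; apply: nat_case.
Qed.

(** Moving [g] to the left past [h - 1] replaces [h] by [h ^ g], which stays in [H]: powers of
    [I(H)] are stable under conjugation by the normaliser. *)
Lemma aug_ann_elt p (H : {group gT}) k g a :
  g \in 'N(H)%g -> aug_ann p H k a -> aug_ann p H k (gr_elt g * a).
Proof.
move=> gN; elim: k a => [|k IH] a /=; first exact: gr_dvdM.
move=> Ha h hH; rewrite mulrA mulrBl mul1r gr_eltM.
have -> : gr_elt (h * g)%g - gr_elt g = gr_elt g * (gr_elt (h ^ g)%g - 1).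
  by rewrite mulrBr mulr1 gr_eltM conjgC.
by rewrite -mulrA; apply/IH/Ha; rewrite memJ_norm.
Qed.

Lemma aug_ann_leq p H k l a :
  (k <= l)%N -> aug_ann p H k a -> aug_ann p H l a.
Proof.
move=> kl Ha; rewrite -(subnK kl); elim: (l - k)%N => // n; rewrite addSn.
elim: (n + k)%N (a) => [|m IH] b Hb h hH; first exact: gr_dvdM.
exact/IH/Hb.
Qed.

(* A monomial of degree [k + j + 1] in [h - 1 (h in H)] and [z - 1] has degree
   at least [k + 1] in [H] or at least [j + 1] in [z]. *)
Lemma aug_ann_join p (H K : {group gT}) z k j a :
    abelian K -> K :=: (<[z]> * H)%g ->
    aug_ann p H k.+1 a -> gr_dvd p ((gr_elt z - 1) ^+ j.+1 * a) ->
  aug_ann p K (k + j).+1 a.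
Proof.
move=> abK defK.
have zK : z \in K by rewrite defK; apply: (subsetP (mulG_subl _ _)); apply: cycle_id.
have HK : H \subset K by rewrite defK mulG_subr.
have KN : K \subset 'N(H)%g by apply: sub_abelian_norm.
have com x y : x \in K -> y \in K -> gr_elt x * gr_elt y = gr_elt y * gr_elt x.
  by move=> xK yK; rewrite !gr_eltM (centsP abK).
have comB x y : x \in K -> y \in K ->
    (gr_elt x - 1) * (gr_elt y - 1) = (gr_elt y - 1) * (gr_elt x - 1).
  move=> xK yK; apply: commrB (commr1 _); apply: commr_sym.
  by apply: commrB (commr1 _); apply: com.
have KNK x : x \in K -> x \in 'N(K)%g by apply/subsetP/normG.
have [n] := ubnP (k + j); elim: n k j a => // n IH k j a ltn Ha Hz m.
rewrite {1}defK => /mulsgP[_ h /cycleP[i ->] hH ->].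
have hK := subsetP HK h hH.
(* Up to a factor in [K], the first summand lowers the degree [k] left for [H], the second the
   degree [j] left for [z]. When that degree is already [0], the product is divisible by [p]
   outright. *)
have -> : gr_elt (z ^+ i * h)%g - 1 =
    gr_elt (z ^+ i)%g * (gr_elt h - 1) + (gr_elt (z ^+ i)%g - 1).
  by rewrite mulrBr mulr1 gr_eltM subrKA.
rewrite -/(aug_ann p K (k + j) _) mulrDl -mulrA; apply: aug_annD.
  apply: aug_ann_elt; first by rewrite KNK ?groupX.
  case: k Ha ltn => [|k] Ha ltn.
    by apply: (@aug_ann_leq p K 0) => //; apply: Ha.
  rewrite addSn; apply: IH => //; first exact: Ha.
  rewrite mulrA -(commrX _ (comB h z hK zK)).
  by rewrite -mulrA; apply: gr_dvdM.
(* The geometric sum isolates one factor [z - 1] next to [a]; the powers of [z] in front are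
   absorbed by [aug_ann_elt]. *)
have -> : gr_elt (z ^+ i)%g - 1 = (\sum_(l < i) gr_elt z ^+ l) * (gr_elt z - 1).
  rewrite -gr_eltX subrX1; symmetry; apply: commrB (commr1 _); apply: commr_sym.
  by apply: commr_sum => l _; apply: commrX.
rewrite -mulrA mulr_suml; apply: aug_ann_sum => l _.
rewrite gr_eltX; apply: aug_ann_elt.
  by rewrite KNK ?groupX.
case: j Hz ltn => [|j] Hz ltn; first exact: (@aug_ann_leq p K 0).
rewrite addnS; apply: IH; first by rewrite addnS in ltn.
- rewrite mulrBl mul1r; apply: aug_annB => //; apply: aug_ann_elt => //.
  exact: (subsetP KN).
- by rewrite mulrA -exprSr.
Qed.

(** Split off a cyclic factor of order [p], generated by [z], with complement [H]. Modulo [p],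
    [(z - 1) ^+ p] is [z ^+ p - 1 = 0], so the exponents [p] for [z] and [#|H|] for [H] join to
    [#|H| + p - 1], at most [p * #|H| = #|M|]. *)
Lemma aug_ann_abelem p (M : {group gT}) a :
  prime p -> p.-abelem%g M -> aug_ann p M #|M| a.
Proof.
move=> pr; have [n] := ubnP #|M|; elim: n M a => // n IH M a ltn abM.
have [M1 | ] := eqVneq (M : {set gT}) 1%g.
  rewrite M1 cards1 => h; rewrite inE => /eqP->.
  by rewrite gr_elt1 subrr mul0r; apply: gr_dvd0.
case/trivgPn=> z zM z1; have zp := abelem_order_p abM zM z1.
have /splitsP[H /complP[tiH defM]] : [splits M, over <[z]>]%g.
  by apply: (@abelem_splits _ p M <[z]>%G) => //; rewrite cycle_subG.
have HM : H \subset M by rewrite -defM mulG_subr.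
have cM : #|M| = (p * #|H|)%N by rewrite -defM TI_cardMg // -orderE zp.
have Hlt : (#|H| < #|M|)%N by rewrite cM ltn_Pmull ?cardG_gt0 ?prime_gt1.
have Ha : aug_ann p H #|H| a.
  by apply: IH (abelemS HM abM); apply: leq_trans Hlt _.
have Hz : gr_dvd p ((gr_elt z - 1) ^+ p * a).
  have [c] := expr1D_modp (gr_elt z - 1) 1 pr; rewrite expn1 addrC subrK gr_eltX.
  rewrite -zp expg_order zp gr_elt1 -addrA => /eqP.
  rewrite -subr_eq0 opprD addNKr oppr_eq0 addr_eq0 => /eqP->.
  by exists (- c * a); rewrite -mulNrn mulrnAl.
rewrite -(prednK (cardG_gt0 H)) in Ha; rewrite -{2}(prednK (prime_gt0 pr)) in Hz.
have := aug_ann_join (abelem_abelian abM) (esym defM) Ha Hz; apply: aug_ann_leq.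
rewrite cM -addSn prednK ?cardG_gt0 //.
case: (p) (prime_gt0 pr) => // p' _; case: #|H| (cardG_gt0 H) => // h _.
by rewrite /= mulSn leq_add2l mulnS leq_addr.
Qed.

(** * The kernel of the reduction modulo [M] and its nilpotency modulo [p] *)

(* For [M] normal in [G] these are the elements of [ZG] in the kernel of
   [omega M] (see [relaug_omega0]). *)
Definition relaug (G M : {set gT}) a :=
  in_ZG G a /\ forall x, \sum_(m in M) a (x * m)%g = 0.

(** Let [t x] be a fixed representative of the coset [xM]. As the coefficients of [a] sum to zero on
    each coset, [a] is a combination of the [x - t x = t x * (m - 1)] with [m] in [M], so it
    supplies one factor from [I(M)]. *)
Lemma relaug_aug_ann p (G M : {group gT}) k a b :
    G \subset 'N(M)%g -> relaug G M a ->
  aug_ann p M k.+1 b -> aug_ann p M k (a * b).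
Proof.
move=> nMG [aG aM] Hb; pose t x := repr (x *: M)%g.
have tP x : exists2 m, m \in M & x = (t x * m)%g.
  have /lcosetP[m mM e] : t x \in (x *: M)%g by apply: mem_repr (lcoset_refl M x).
  by exists m^-1%g; rewrite ?groupV // e mulgK.
(* Averaging over right translations by [M], which fix [t], makes the coset sums of [a] appear;
   torsion-freeness then removes the factor [#|M|]. *)
have St0 : \sum_x gr_elt (t x) *~ a x = 0.
  apply: (@gr_mulrnI #|M|); first exact: cardG_gt0.
  rewrite mul0rn -sumr_const.
  rewrite (eq_bigr (fun m => \sum_x gr_elt (t x) *~ a (x * m)%g)) => [|m mM].
    rewrite exchange_big big1 //= => x _.
    by rewrite -mulrz_sumr aM.
  rewrite (reindex_inj (mulIg m)); apply: eq_bigr => x _.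
  by rewrite /t lcosetM lcoset_id.
rewrite [a]gr_sum_elt -[\sum_x _]subr0 -[in X in _ - X]St0 -sumrB mulr_suml.
apply: aug_ann_sum => x _; have [m mM xE] := tP x.
have [xG|xG] := boolP (x \in G); last first.
  have /forallP/(_ x) := aG; rewrite xG => /eqP->.
  by rewrite !mulr0z subrr mul0r; apply: aug_ann0.
rewrite -mulrzBl mulrzAl; apply: aug_annMz.
have -> : gr_elt x - gr_elt (t x) = gr_elt (t x) * (gr_elt m - 1).
  by rewrite mulrBr mulr1 gr_eltM -xE.
rewrite -mulrA; apply: aug_ann_elt; last exact: Hb.
have -> : t x = (x * m^-1)%g by rewrite {2}xE mulgK.
by rewrite groupM ?groupV ?(subsetP nMG x xG) // (subsetP (normG M)).
Qed.

(** Starting from [aug_ann_abelem] applied to [1], each factor [a] uses up one degree. *)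
Lemma relaug_nil p (G M : {group gT}) a : prime p -> p.-abelem%g M ->
  G \subset 'N(M)%g -> relaug G M a -> gr_dvd p (a ^+ #|M|).
Proof.
move=> pr abM nMG Ja; have := aug_ann_abelem 1 pr abM.
rewrite -[a ^+ _]mulr1; elim: #|M| (1 : gr gT) => [|k IH] b; first by rewrite mul1r.
by rewrite exprSr -mulrA => Hb; apply/IH/(relaug_aug_ann nMG).
Qed.

(** * Closure properties of [in_ZG], [relaug] and [gr_dvd] *)

Lemma in_ZGP (G : {set gT}) a : reflect (forall x, x \notin G -> a x = 0) (in_ZG G a).
Proof. by apply: (iffP forall_inP) => h x xG; apply/eqP/h. Qed.

Lemma in_ZG1 (G : {group gT}) : in_ZG G (1 : gr gT).
Proof. by apply/in_ZGP => x xG; rewrite ffunE; case: eqP xG => // ->; rewrite group1. Qed.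

Lemma in_ZGB (G : {set gT}) a b : in_ZG G a -> in_ZG G b -> in_ZG G (a - b).
Proof.
by move=> /in_ZGP aG /in_ZGP bG; apply/in_ZGP => x xG; rewrite !ffunE aG ?bG ?subrr.
Qed.

Lemma in_ZGM (G : {group gT}) a b : in_ZG G a -> in_ZG G b -> in_ZG G (a * b).
Proof.
move=> /in_ZGP aG /in_ZGP bG; apply/in_ZGP => x xG; rewrite gr_mulE big1 // => y _.
have [yG|/aG->] := boolP (y \in G); last by rewrite mul0r.
by rewrite bG ?mulr0 // groupMl ?groupV.
Qed.

Lemma in_ZGX (G : {group gT}) a n : in_ZG G a -> in_ZG G (a ^+ n).
Proof. by move=> aG; elim: n => [|n IH]; rewrite ?in_ZG1 // exprS in_ZGM. Qed.

Lemma relaug0 G M : relaug G M 0.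
Proof.
split; first by apply/in_ZGP => x _; rewrite ffunE.
by move=> x; rewrite big1 // => m _; rewrite ffunE.
Qed.

Lemma relaugB G M a b : relaug G M a -> relaug G M b -> relaug G M (a - b).
Proof.
move=> [aG aM] [bG bM]; split; first exact: in_ZGB.
move=> x; under eq_bigr do rewrite !ffunE.
by rewrite sumrB aM bM subrr.
Qed.

Lemma relaugD G M a b : relaug G M a -> relaug G M b -> relaug G M (a + b).
Proof.
move=> Ja Jb; rewrite -[b]opprK -[- b]sub0r.
by apply: relaugB => //; apply: relaugB => //; apply: relaug0.
Qed.

Lemma relaugM (G : {group gT}) M a b : in_ZG G a -> relaug G M b -> relaug G M (a * b).
Proof.
move=> aG [bG bM]; split; first exact: in_ZGM.
move=> x; under eq_bigr do rewrite gr_mulE.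
rewrite exchange_big big1 //= => y _; rewrite -mulr_sumr.
by under eq_bigr do rewrite mulgA; rewrite bM mulr0.
Qed.

Lemma relaug_divn G M a n : (0 < n)%N -> relaug G M (a *+ n) -> relaug G M a.
Proof.
have inj k : (0 < n)%N -> k *+ n = 0 -> k = 0 :> int.
  by move=> n0 /eqP; rewrite Num.Theory.mulrn_eq0 gtn_eqF // => /eqP.
move=> n0 [/in_ZGP aG aM]; split.
  by apply/in_ZGP => x /aG; rewrite gr_mulrnE; apply: inj.
move=> x; apply: inj => //; rewrite -sumrMnl -[RHS](aM x).
by apply: eq_bigr => m _; rewrite gr_mulrnE.
Qed.

Lemma in_ZG_relaug (G : {group gT}) M u : relaug G M (u - 1) -> in_ZG G u.
Proof.
move=> [uG _]; have /in_ZGP h1 := in_ZG1 G; move/in_ZGP: uG => h.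
by apply/in_ZGP => x xG; have := h x xG; rewrite ffunE [X in _ + X]ffunE h1 // subr0.
Qed.

Lemma relaugX1 (G : {group gT}) M u n : relaug G M (u - 1) -> relaug G M (u ^+ n - 1).
Proof.
move=> Ju; elim: n => [|n IH]; first by rewrite subrr; apply: relaug0.
have -> : u ^+ n.+1 - 1 = u * (u ^+ n - 1) + (u - 1).
  by rewrite exprS mulrBr mulr1 subrKA.
by apply: relaugD => //; apply: relaugM IH; apply: in_ZG_relaug Ju.
Qed.

Lemma gr_dvdX1 p u n : gr_dvd p (u - 1) -> gr_dvd p (u ^+ n - 1).
Proof.
move=> pu; elim: n => [|n IH]; first by rewrite subrr; apply: gr_dvd0.
have -> : u ^+ n.+1 - 1 = u * (u ^+ n - 1) - (0 - (u - 1)).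
  by rewrite exprS mulrBr mulr1 sub0r opprK subrKA.
by apply: gr_dvdB; [apply: gr_dvdM | apply: gr_dvdB => //; apply: gr_dvd0].
Qed.

Lemma gr_dvd_coprime p q a : prime p -> prime q -> q != p -> gr_dvd p (a *+ q) -> gr_dvd p a.
Proof.
move=> pr qr ne [c ac]; case: (egcdnP p (prime_gt0 qr)) => m n e _.
have gcd1 : gcdn q p = 1%N by apply/eqP; rewrite -/(coprime q p) prime_coprime // dvdn_prime2.
(* The witness comes from the Bezout relation [m * q = n * p + 1]. *)
exists (c *+ m - a *+ n); rewrite mulrnBl -!mulrnA [(m * p)%N]mulnC mulrnA -ac.
by rewrite -mulrnA [(q * m)%N]mulnC e gcd1 mulrnDr mulr1n addrAC subrr add0r.
Qed.

Lemma gr_dvdX_eq0 p a : prime p -> (forall k, gr_dvd (p ^ k) a) -> a = 0.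
Proof.
move=> pr pa; apply/ffunP => x; rewrite ffunE.
(* The exponent is the absolute value of the coefficient itself, because a positive integer [k] is
   less than [p ^ k]. *)
have [c /ffunP/(_ x)] := pa `|a x|%N; rewrite gr_mulrnE => ax.
have : (p ^ `|a x| %| `|a x|)%N.
  by rewrite {2}ax -mulr_natr abszM natz absz_nat dvdn_mull.
apply: contraTeq; rewrite -absz_eq0 -lt0n => ax0.
by apply/negP => /(dvdn_leq ax0); rewrite leqNgt ltn_expl ?prime_gt1.
Qed.

(** * Torsion units over an elementary abelian normal subgroup *)

Section Torsion.
Variables (p : nat) (G M : {group gT}).
Hypotheses (pr : prime p) (abM : p.-abelem%g M) (nMG : G \subset 'N(M)%g).

(** Writing [a = p ^ k.+1 * x] gives [p ^ k.+1 * x ^ 2 = q * x], from which one more factor [p] is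
    extracted. For [q] different from [p] this is coprimality; for [q = p] one cancels to
    [p ^ k * x ^ 2 = x], which leaves only [k = 0] to settle. *)
Lemma relaug_idem_eq0 q a :
  prime q -> relaug G M a -> gr_dvd p a -> a * a = a *+ q -> a = 0.
Proof.
move=> qr Ja pa aa; apply: (gr_dvdX_eq0 pr) => k.
suff : gr_dvd (p ^ k.+1) a.
  by move=> [c ->]; exists (c *+ p); rewrite -mulrnA -expnS.
elim: k => [|k [x ax]]; first by rewrite expn1.
have pk0 j : (0 < p ^ j)%N by rewrite expn_gt0 prime_gt0.
have xx : (x * x) *+ p ^ k.+1 = x *+ q.
  apply: (gr_mulrnI (pk0 k.+1)); move: aa; rewrite ax mulrnAl mulrnAr => ->.
  by rewrite mulrnAC.
suff [c xc] : gr_dvd p x by exists c; rewrite ax xc -mulrnA -expnS.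
have [qp|qp] := eqVneq q p; last first.
  by apply: (gr_dvd_coprime pr qr qp); rewrite -xx; exists ((x * x) *+ p ^ k); rewrite -mulrnA -expnSr.
have {}xx : (x * x) *+ p ^ k = x.
  by apply: (gr_mulrnI (prime_gt0 pr)); rewrite -mulrnA -expnSr xx qp.
case: k => [|k] in ax xx *; last by exists ((x * x) *+ p ^ k); rewrite -mulrnA -expnSr xx.
(* Here [x] is an idempotent of the kernel, hence equal to its power [x ^+ #|M|], which is divisible
   by [p]. *)
have xi i : x ^+ i.+1 = x.
  by elim: i => // i IH; rewrite exprS IH -[RHS]xx.
have Jx : relaug G M x by apply: (relaug_divn (pk0 1%N)); rewrite -ax.
by have := relaug_nil pr abM nMG Jx; rewrite -(prednK (cardG_gt0 M)) xi.
Qed.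

Lemma relaug_prime_torsion q w :
    prime q -> relaug G M (w - 1) -> gr_dvd p (w - 1) -> w ^+ q = 1 -> w = 1.
Proof.
move=> qr Jw pw wq; pose s := \sum_(i < q) w ^+ i.
have ws : (w - 1) * s = 0 by rewrite -subrX1 wq subrr.
have {ws} ws : w * s = s by apply/eqP; rewrite -subr_eq0 -{2}[s]mul1r -mulrBl ws.
have ss : s * s = s *+ q.
  rewrite {1}/s mulr_suml -[X in _ *+ X]card_ord -sumr_const; apply: eq_bigr => i _.
  by elim: (i : nat) => [|j IH]; rewrite ?mul1r // exprS -mulrA IH.
(* Each term [1 - w ^+ i] lies in the kernel and is divisible by [p], hence so does and is the
   sum. *)
have fE : q%:R - s = \sum_(i < q) (0 - (w ^+ i - 1)).
  rewrite (eq_bigr (fun i : 'I_q => 1 - w ^+ i)) => [|i _]; last by rewrite sub0r opprB.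
  by rewrite sumrB sumr_const card_ord.
have f0 : q%:R - s = 0.
  apply: (relaug_idem_eq0 qr).
  - rewrite fE; apply: (big_ind (relaug G M)); [exact: relaug0 | by move=> *; apply: relaugD|].
    by move=> i _; apply: relaugB (relaug0 _ _) _; apply: relaugX1.
  - rewrite fE; apply: (big_ind (gr_dvd p)); first exact: gr_dvd0.
      by move=> _ _ [c ->] [d ->]; exists (c + d); rewrite mulrnDl.
    by move=> i _; apply: gr_dvdB (gr_dvd0 _) _; apply: gr_dvdX1.
  - by rewrite mulrBl mulr_natl mulrBr ss mulr_natr subrr subr0.
(* Now [s = q], so [w * s = s] reads [q * w = q]. *)
apply: (gr_mulrnI (prime_gt0 qr)); rewrite -mulr_natr.
by move/eqP: f0; rewrite subr_eq0 => /eqP->; rewrite ws.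
Qed.

(** For [q] the least prime factor of [n], the prime case applies to the power of [w] of exponent
    [n / q], which leaves a smaller exponent killing [w]. *)
Lemma relaug_torsion n w :
    (0 < n)%N -> relaug G M (w - 1) -> gr_dvd p (w - 1) -> w ^+ n = 1 -> w = 1.
Proof.
have [k] := ubnP n; elim: k n => // k IH n ltn n0 Jw pw wn.
have [n1|n1] := leqP n 1.
  by rewrite -[w]expr1 -wn; congr (_ ^+ _); apply/eqP; rewrite eqn_leq n1 n0.
have qr := pdiv_prime n1; have qn := pdiv_dvd n.
apply: (IH (n %/ pdiv n)%N) => //.
- by apply: leq_trans (ltn_Pdiv (prime_gt1 qr) n0) _.
- by rewrite divn_gt0 ?pdiv_gt0 // pdiv_leq.
apply: (relaug_prime_torsion qr); [exact: relaugX1 | exact: gr_dvdX1 |].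
by rewrite -exprM divnK.
Qed.

Lemma relaug_expr_card u n :
  (0 < n)%N -> relaug G M (u - 1) -> u ^+ n = 1 -> u ^+ #|M| = 1.
Proof.
move=> n0 Ju un; apply: (relaug_torsion n0); first exact: relaugX1.
  have [r cM] := p_natP (abelem_pgroup abM).
  have [d ud] := relaug_nil pr abM nMG Ju.
  have [c] := expr1D_modp (u - 1) r pr; rewrite -cM addrC subrK ud => ->.
  by exists (d + c); rewrite mulrnDl -[1 + _ + _]addrA [1 + _]addrC addrK.
by rewrite -exprM mulnC exprM un expr1n.
Qed.

End Torsion.
End GroupRing.

(** * The reduction map [omega M] and its kernel *)

Section Omega.
Variables (gT : finGroupType) (M : {group gT}).
Implicit Types a b : gr gT.

Lemma omegaB a b : omega M (a - b) = omega M a - omega M b.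
Proof.
by apply/ffunP => C; rewrite !ffunE -sumrB; apply: eq_bigr => x _; rewrite !ffunE.
Qed.

Lemma omega1 : omega M (1 : gr gT) = 1.
Proof.
apply/ffunP => C; rewrite !ffunE.
under eq_bigr do rewrite ffunE.
rewrite -big_mkcondr (eq_bigl (fun x => (C == 1%g) && (x == 1%g))) => [|x] /=.
  by case: (C == 1%g) => /=; rewrite ?big_pred1_eq ?big_pred0_eq.
case: (eqVneq x 1%g) => [->|]; rewrite ?andbF // coset_id ?group1 //.
by rewrite eq_sym.
Qed.

(** The supports matter: [coset M] is multiplicative on the normaliser of [M] only and takes the
    default value [1] outside it. *)
Lemma omegaM a b : in_ZG 'N(M)%g a -> in_ZG 'N(M)%g b ->
  omega M (a * b) = omega M a * omega M b.
Proof.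
move=> /in_ZGP aN /in_ZGP bN; apply/ffunP => C; rewrite gr_mulE ffunE.
under eq_bigr do rewrite gr_mulE.
rewrite exchange_big /= (partition_big (coset M) predT) //=.
apply: eq_bigr => D _; rewrite ffunE mulr_suml; apply: eq_bigr => y /eqP yD.
have [yN|/aN->] := boolP (y \in 'N(M)%g); last by rewrite mul0r big1 // => *; rewrite mul0r.
rewrite -mulr_sumr; congr (_ * _); rewrite ffunE (reindex_inj (mulgI y)).
rewrite big_mkcond [RHS]big_mkcond; apply: eq_bigr => z _ /=; rewrite mulKg.
have [zN|/bN->] := boolP (z \in 'N(M)%g); last by rewrite !if_same.
by rewrite morphM //= yD (can2_eq (mulKg D) (mulKVg D)).
Qed.

Lemma omegaX a n : in_ZG 'N(M)%g a -> omega M (a ^+ n) = omega M a ^+ n.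
Proof.
by move=> aN; elim: n => [|n IH]; rewrite ?omega1 // !exprS omegaM ?in_ZGX // IH.
Qed.

(** The sum over [xN] is taken one coset of [M] at a time. The case [N = M] identifies the kernel of
    [omega M]; the general case carries [relaug] over to the quotient by [M]. *)
Lemma sum_omega (N : {group gT}) a x : (M <| N)%g -> x \in 'N(M)%g -> in_ZG 'N(M)%g a ->
  \sum_(C in (N / M)%g) omega M a (coset M x * C)%g = \sum_(m in N) a (x * m)%g.
Proof.
move=> nMN xN /in_ZGP aN.
transitivity (\sum_(C in (N / M)%g) \sum_(m | coset M (x * m) == (coset M x * C)%g) a (x * m)%g).
  by apply: eq_bigr => C _; rewrite ffunE (reindex_inj (mulgI x)).
rewrite (exchange_big_dep predT) //= [RHS]big_mkcond; apply: eq_bigr => m _.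
have [mN|mN] := boolP (m \in 'N(M)%g); last first.
  by rewrite aN ?groupMl // big1 // if_same.
have mNM : (coset M m \in (N / M)%g) = (m \in N).
  apply/idP/idP => [mQ|]; last exact: mem_quotient.
  by rewrite -(quotientGK nMN) mem_morphpre.
under eq_bigl => C do rewrite morphM // (inj_eq (mulgI _)).
rewrite -mNM; case: ifP => [mQ | mQ].
  by rewrite (big_pred1 (coset M m)) // => C; rewrite /= eq_sym; case: eqP => [->|]; rewrite ?andbF ?mQ.
by rewrite big_pred0 // => C; case: eqP => [<-|]; rewrite ?andbF ?mQ.
Qed.

Lemma in_ZG_sub (A B : {set gT}) a : A \subset B -> in_ZG A a -> in_ZG B a.
Proof. by move=> sAB /in_ZGP aA; apply/in_ZGP => x xB; apply/aA/(contra (subsetP sAB x)). Qed.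

Lemma relaug_omega0 (G : {group gT}) a :
  G \subset 'N(M)%g -> in_ZG G a -> omega M a = 0 -> relaug G M a.
Proof.
move=> nMG aG a0; split=> // x; have aN := in_ZG_sub nMG aG.
have [xN|xN] := boolP (x \in 'N(M)%g).
  by rewrite -sum_omega // a0 big1 // => C _; rewrite ffunE.
rewrite big1 // => m mM; move/in_ZGP: aN; apply.
by rewrite groupMr // (subsetP (normG M)).
Qed.

Lemma relaug_omega (G N : {group gT}) a : (M <| N)%g -> G \subset 'N(M)%g ->
  relaug G N a -> relaug (G / M)%g (N / M)%g (omega M a).
Proof.
move=> nMN nMG [aG aN]; split.
  apply/in_ZGP => C CG; rewrite ffunE big1 // => x /eqP xC.
  move/in_ZGP: aG; apply; apply: contra CG => xG.
  by rewrite -xC mem_quotient.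
move=> D; have [x xN ->] := cosetP D.
by rewrite sum_omega // (in_ZG_sub nMG).
Qed.

End Omega.

(** * Induction on the order of the solvable normal subgroup *)

Lemma relaug_sol_expr (gT : finGroupType) (G N : {group gT}) (u : gr gT) n :
    (N <| G)%g -> solvable N -> (0 < n)%N -> relaug G N (u - 1) -> u ^+ n = 1 ->
  u ^+ #|N| = 1.
Proof.
(* The ambient type is generalised too, since the image of [u] lives over [coset_of M]. *)
have [k] := ubnP #|N|; elim: k gT G N u => // k IH gT G N u ltk nNG solN n0 Ju un.
have [N1|ntN] := eqVneq (N : {set gT}) 1%g.
  (* For trivial [N] the coset sums are single coefficients, so [u - 1] vanishes. *)
  rewrite N1 cards1 expr1; apply/eqP; rewrite -subr_eq0; apply/eqP/ffunP => x.
  by case: Ju => _ /(_ x); rewrite N1 big_set1 mulg1 => ->; rewrite ffunE.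
have [M minM sMN] := minnormal_exists ntN (normal_norm nNG).
have [nMG ntM abM] := minnormal_solvable minM sMN solN.
have sNG := normal_sub nNG.
have nMN : (M <| N)%g by rewrite /normal sMN (subset_trans sNG).
have prp : prime (pdiv #|M|) by rewrite pdiv_prime // cardG_gt1.
have uG := in_ZG_relaug Ju; have uN := in_ZG_sub nMG uG.
have Jbar := relaug_omega nMN nMG Ju; rewrite omegaB omega1 in Jbar.
have ubar : omega M u ^+ #|(N / M)%g| = 1.
  apply: (IH _ (G / M)%G (N / M)%G) Jbar _ => //.
  - exact: leq_trans (ltn_quotient ntM sMN) ltk.
  - exact: quotient_normal.
  - exact: quotient_sol.
  - by rewrite -omegaX // un omega1.
have cN : #|N| = (#|(N / M)%g| * #|M|)%N.
  by rewrite card_quotient ?normal_norm // mulnC Lagrange.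
(* By [ubar], the power of [u] of exponent [#|N / M|] is [1] modulo the kernel of [omega M], and it
   is still killed by [n]. *)
rewrite cN exprM; apply: (relaug_expr_card prp abM nMG n0).
  apply: relaug_omega0 => //; first by rewrite in_ZGB ?in_ZGX ?in_ZG1.
  by rewrite omegaB omega1 omegaX // ubar subrr.
by rewrite -exprM mulnC exprM un expr1n.
Qed.

Local Close Scope ring_scope.

(* If u in V(ZG,N) is torsion with (multiplicative) order n, then n divides |N|. *)
Theorem mainTheorem3 (gT : finGroupType) (G N : {group gT})
  (nNG : (N <| G)%g) (solN : solvable N) (u : gr gT)
  (uV : in_VZGN G N u)
  (n : nat) (n_gt0 : 0 < n) (un : gr_exp u n = gr_one gT)
  (nmin : forall m, 0 < m < n -> gr_exp u m <> gr_one gT) :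
  n %| #|N|.
Proof.
have [[uG _] _ u1] := uV; rewrite gr_expE in un.
have uN1 : (u ^+ #|N| = 1)%R.
  apply: (relaug_sol_expr nNG solN n_gt0) un.
  apply: relaug_omega0; rewrite ?normal_norm ?in_ZGB ?in_ZG1 //.
  by rewrite omegaB omega1 u1 subrr.
(* A nonzero remainder of [#|N|] modulo [n] would be a positive exponent below [n] killing [u]. *)
rewrite /dvdn; apply/negPn/negP => mn; apply: (nmin (#|N| %% n)%N).
  by rewrite lt0n mn ltn_mod.
rewrite gr_expE; move: uN1; rewrite {1}(divn_eq #|N| n) exprD mulnC exprM un.
by rewrite expr1n mul1r.
Qed.
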